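(* Let $n,p$ be positive integers, $\sigma>0$, $\mu\in\mathbb{R}^n$, and let $\mathbb{X}$ be any real (deterministic) matrix of size $n\times p$. Let $y=\mu+\xi$, where the random vector $\xi$ in $\mathbb{R}^n$ satisfies $\mathbb{E}[\exp(v^T\xi)]\le \exp(\sigma^2|v|_2^2/2)$ for all $v\in\mathbb{R}^n$. Let $\hat F$ be any data-driven nonempty collection of subsets of $\{1,\dots,p\}$, let $\hat\sigma^2\ge 0$ be any real-valued estimator and let $\delta=\mathbb{P}(\hat\sigma^2<\sigma^2)$. Let $\hat\mu^{Q}$ and $\Pi_{\hat T}y$ be the two estimators built from $\hat F$ and $\hat\sigma^2$ that are defined in the context. (i) For all $x>0$, with probability greater than $1-\delta-2\exp(-x)$, $$\|\hat\mu^{Q}-\mu\|^2\le \min_{T\in\hat F}\left(\|\Pi_T\mu-\mu\|^2+\frac{\hat\sigma^2}{n}\left(24+96|T|\log\left(\frac{ep}{|T|\vee 1}\right)\right)\right)+\frac{22\sigma^2x}{n}.$$ (ii) For all $x>0$, with probability greater than $1-\delta-2\exp(-x)$, $$\|\Pi_{\hat T}y-\mu\|^2\le \min_{T\in\hat F}\left(3\|\Pi_T\mu-\mu\|^2+\frac{\hat\sigma^2}{n}\left(26+104|T|\log\left(\frac{ep}{|T|\vee 1}\right)\right)\right)+\frac{28\sigma^2x}{n}.$$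
   Context: Notation: $|\cdot|_2$ is the Euclidean norm on $\mathbb{R}^n$, $\|u\|^2=\frac1n|u|_2^2$ for $u\in\mathbb{R}^n$, and $a\vee b=\max(a,b)$. The vector $\mu$ is unknown and only $y$ is observed; ''estimator'' and ''data-driven'' mean depending (measurably) on $y$; both the elements and the cardinality of $\hat F$ may depend on $y$. No relation between $\mu$ and $\mathbb{X}$ is assumed. A support is a subset $T\subset\{1,\dots,p\}$; $|T|$ is its cardinality and $\Pi_T\in\mathbb{R}^{n\times n}$ is the orthogonal projection onto the linear span of the columns of $\mathbb{X}$ with indices in $T$. Weights: for every support $T$, $$\pi_T=\left(H_p\binom{p}{|T|}e^{|T|}\right)^{-1},\qquad H_p=\frac{e-e^{-p}}{e-1}.$$ Estimator $\hat\mu^Q$: let $\hat M$ be the cardinality of $\hat F$, write $\hat F=\{\hat T_1,\dots,\hat T_{\hat M}\}$, $\hat\mu_j=\Pi_{\hat T_j}y$, and $\hat\mu_\theta=\sum_{j=1}^{\hat M}\theta_j\hat\mu_j$ for $\theta\in\mathbb{R}^{\hat M}$. Let $\Lambda^{\hat M}=\{\theta\in\mathbb{R}^{\hat M}:\ \sum_j\theta_j=1,\ \theta_j\ge0\ \forall j\}$ and, for $\theta\in\Lambda^{\hat M}$, $$H(\theta)=|\hat\mu_\theta-y|_2^2+\frac12\sum_{j=1}^{\hat M}\theta_j|\hat\mu_j-\hat\mu_\theta|_2^2+26\hat\sigma^2\sum_{j=1}^{\hat M}\theta_j\log\frac1{\pi_{\hat T_j}}.$$ Then $\hat\mu^Q=\hat\mu_{\hat\theta}$,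 where $\hat\theta$ is any minimizer of $H$ over $\Lambda^{\hat M}$. Estimator $\Pi_{\hat T}y$: $\hat T$ is any minimizer over $T\in\hat F$ of the criterion $|y-\Pi_Ty|_2^2+18\hat\sigma^2\log\frac1{\pi_T}$. *)

(* Defs.v *)
From HB Require Import structures.
From mathcomp Require Import all_boot all_order all_algebra.
From mathcomp Require Import all_classical all_reals all_analysis.

Set Implicit Arguments.
Unset Strict Implicit.
Unset Printing Implicit Defensive.

Import Order.TTheory GRing.Theory Num.Theory.
Import numFieldNormedType.Exports.

Local Open Scope classical_set_scope.
Local Open Scope ring_scope.

(* Borel sets of R^n, as the sigma-algebra generated by the coordinates, which is
   also the library's sigma-algebra on n.-tuple R. *)
Definition cV_measurable (R : realType) (n : nat) : set (set 'cV[R]_n) :=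
  g_sigma_preimage (fun (i : 'I_n) (u : 'cV[R]_n) => u i 0).

Lemma cV_measurable0 (R : realType) (n : nat) : @cV_measurable R n set0.
Proof. exact: sigma_algebra0. Qed.

Lemma cV_measurableC (R : realType) (n : nat) (A : set 'cV[R]_n) :
  cV_measurable A -> cV_measurable (~` A).
Proof. exact: sigma_algebraC. Qed.

Lemma cV_measurable_bigcup (R : realType) (n : nat) (A : (set 'cV[R]_n)^nat) :
  (forall i, cV_measurable (A i)) -> cV_measurable (\bigcup_i (A i)).
Proof. exact: sigma_algebra_bigcup. Qed.

HB.instance Definition _ (R : realType) (n : nat) :=
  @isMeasurable.Build default_measure_display 'cV[R]_n (@cV_measurable R n)
    (@cV_measurable0 R n) (@cV_measurableC R n) (@cV_measurable_bigcup R n).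

Definition sqnorm2 (R : realType) (n : nat) (u : 'cV[R]_n) : R :=
  \sum_i u i 0 ^+ 2.

Definition sqnorm (R : realType) (n : nat) (u : 'cV[R]_n) : R :=
  n%:R^-1 * sqnorm2 u.

(* The row space of suppmx X T is the span of the (transposed) columns of X with
   index in T, and that of kermx (suppmx X T)^T is its orthogonal complement. The
   outer transpose in Pi is there because proj_mx acts on row vectors, whereas
   Pi X T acts on column vectors. *)
Definition suppmx (R : realType) (n p : nat) (X : 'M[R]_(n, p))
    (T : {set 'I_p}) : 'M[R]_(p, n) :=
  \matrix_(j, i) (if j \in T then X i j else 0).

Definition Pi (R : realType) (n p : nat) (X : 'M[R]_(n, p)) (T : {set 'I_p}) :
    'M[R]_n :=
  (proj_mx <<suppmx X T>>%MS (kermx (suppmx X T)^T))^T.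

Definition Hp (R : realType) (p : nat) : R :=
  (expR 1 - expR (- p%:R)) / (expR 1 - 1).

Definition weight (R : realType) (p : nat) (T : {set 'I_p}) : R :=
  (Hp R p * 'C(p, #|T|)%:R * expR 1 ^+ #|T|)^-1.

Section QAggregation.
Variables (R : realType) (n p : nat) (X : 'M[R]_(n, p)).
Variables (F : {set {set 'I_p}}) (y : 'cV[R]_n) (s2 : R).

(* The elements of F are numbered by enum_val : 'I_#|F| -> {set 'I_p}. *)
Definition muj (j : 'I_#|F|) : 'cV[R]_n := Pi X (enum_val j) *m y.

Definition mutheta (theta : 'cV[R]_#|F|) : 'cV[R]_n :=
  \sum_j theta j 0 *: muj j.

Definition simplex : set 'cV[R]_#|F| :=
  [set theta | \sum_j theta j 0 = 1 /\ forall j, 0 <= theta j 0].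

Definition Qcrit (theta : 'cV[R]_#|F|) : R :=
  sqnorm2 (mutheta theta - y)
  + 2^-1 * \sum_j theta j 0 * sqnorm2 (muj j - mutheta theta)
  + 26 * s2 * \sum_j theta j 0 * ln (1 / weight R (enum_val j)).

Definition Qminimizer (theta : 'cV[R]_#|F|) : Prop :=
  simplex theta /\ forall theta', simplex theta' -> Qcrit theta <= Qcrit theta'.

Definition selcrit (T : {set 'I_p}) : R :=
  sqnorm2 (y - Pi X T *m y) + 18 * s2 * ln (1 / weight R T).

Definition selminimizer (T : {set 'I_p}) : Prop :=
  T \in F /\ forall T', T' \in F -> selcrit T <= selcrit T'.

End QAggregation.

(* The value +oo is only taken on an empty F. *)
Definition min_in (R : realType) (p : nat) (F : {set {set 'I_p}})
    (f : {set 'I_p} -> R) : \bar R :=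
  \big[Order.min/+oo%E]_(T in F) (f T)%:E.

Definition logterm (R : realType) (p : nat) (T : {set 'I_p}) : R :=
  #|T|%:R * ln (expR 1 * p%:R / (maxn #|T| 1)%:R).

(* Main.v *)
Require Import Defs.
From HB Require Import structures.
From mathcomp Require Import all_boot all_order all_algebra.
From mathcomp Require Import all_classical all_reals all_analysis.
From mathcomp Require Import measurable_realfun ring lra.

Set Implicit Arguments.
Unset Strict Implicit.
Unset Printing Implicit Defensive.

Import Order.TTheory GRing.Theory Num.Theory.
Import numFieldNormedType.Exports.

Local Open Scope classical_set_scope.
Local Open Scope ring_scope.

(* Write L_T = log (1 / pi_T); then |T| <= L_T <= 1/2 + 2 |T| log (ep / (|T| v 1)),
   and the weights sum to 1, so deviations may be paid for by the L_T in union bounds.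

   (i) The criterion H is quadratic with a strongly convex part |mu_theta|^2 / 2, so
   optimality of theta towards the vertex k gives |mu_theta - mu|^2 <=
   |mu_k - mu|^2 + sum_j theta_j (2 xi.(mu_j - mu_k) - |mu_j - mu_k|^2 / 2 - 26 s2 L_j)
   + 26 s2 L_k. Since mu_j - mu_k lies in the span V of the columns indexed by
   T_j u T_k, each summand and |Pi_k xi|^2 are controlled by the squared norm of the
   projection of xi on V.

   (ii) Comparing the criterion at That and at T leaves, besides the bias, a term in T
   linear in xi and a term in That that combines a linear and a quadratic form in xi.

   Both parts rest on a bound on E exp (v.xi + |proj_V xi|^2 / (4 sigma^2)), obtained
   by linearizing the square with an independent Gaussian, one dimension at a time. *)

(** * Euclidean geometry and the projections *)

Definition dot (R : realType) (n : nat) (u v : 'cV[R]_n) : R := (u^T *m v) 0 0.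

Section Dot.
Variables (R : realType) (n : nat).
Implicit Types (u v w : 'cV[R]_n) (a : R).

Lemma dotE u v : dot u v = \sum_i u i 0 * v i 0.
Proof. by rewrite /dot mxE; apply: eq_bigr => i _; rewrite mxE. Qed.

Lemma dotC u v : dot u v = dot v u.
Proof. by rewrite !dotE; apply: eq_bigr => i _; rewrite mulrC. Qed.

Lemma dotDr u v w : dot u (v + w) = dot u v + dot u w.
Proof. by rewrite /dot mulmxDr mxE. Qed.

Lemma dotNr u v : dot u (- v) = - dot u v.
Proof. by rewrite /dot mulmxN mxE. Qed.

Lemma dotZr a u v : dot u (a *: v) = a * dot u v.
Proof. by rewrite /dot -scalemxAr mxE. Qed.

Lemma dot0r u : dot u 0 = 0.
Proof. by rewrite /dot mulmx0 mxE. Qed.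

Lemma dotDl u v w : dot (v + w) u = dot v u + dot w u.
Proof. by rewrite !(dotC _ u) dotDr. Qed.

Lemma dotNl u v : dot (- v) u = - dot v u.
Proof. by rewrite !(dotC _ u) dotNr. Qed.

Lemma dotZl a u v : dot (a *: v) u = a * dot v u.
Proof. by rewrite !(dotC _ u) dotZr. Qed.

Lemma dot_sumr (I : Type) (r : seq I) (P : pred I) (f : I -> 'cV[R]_n) u :
  dot u (\sum_(i <- r | P i) f i) = \sum_(i <- r | P i) dot u (f i).
Proof.
by elim/big_rec2: _ => [|i y1 y2 _ <-]; rewrite ?dot0r ?dotDr.
Qed.

Lemma sqnorm2E u : sqnorm2 u = dot u u.
Proof. by rewrite dotE; apply: eq_bigr => i _; rewrite expr2. Qed.

Lemma dot_ge0 u : 0 <= dot u u.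
Proof. by rewrite -sqnorm2E; apply: sumr_ge0 => i _; rewrite sqr_ge0. Qed.

Lemma dot_eq0 u : (dot u u == 0) = (u == 0).
Proof.
apply/eqP/eqP => [|->]; last by rewrite dot0r.
rewrite -sqnorm2E => u0; apply/colP => i; rewrite mxE.
apply/eqP; rewrite -sqrf_eq0; apply/eqP.
by apply: (psumr_eq0P _ u0) => // j _; rewrite sqr_ge0.
Qed.

Definition dotL := (dotDl, dotDr, dotNl, dotNr, dotZl, dotZr).

Lemma sqnorm2D u v : sqnorm2 (u + v) = sqnorm2 u + 2 * dot u v + sqnorm2 v.
Proof. by rewrite !sqnorm2E !dotL (dotC v u); ring. Qed.

Lemma sqnorm2N u : sqnorm2 (- u) = sqnorm2 u.
Proof. by rewrite !sqnorm2E !dotL opprK. Qed.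

Lemma sqnorm2Z a u : sqnorm2 (a *: u) = a ^+ 2 * sqnorm2 u.
Proof. by rewrite !sqnorm2E dotZl dotZr mulrA expr2. Qed.

Lemma sqnorm2_ge0 u : 0 <= sqnorm2 u.
Proof. by rewrite sqnorm2E dot_ge0. Qed.

End Dot.

Section Orthonormal.
Variables (R : realType) (n : nat).
Implicit Types (u v w : 'cV[R]_n) (U : seq 'cV[R]_n).

(** Recursive on the list, so that inductions peel off one direction at a time. *)
Fixpoint orthonormal U : Prop :=
  if U is u :: U' then
    [/\ dot u u = 1, forall v, v \in U' -> dot u v = 0 & orthonormal U']
  else True.

(** For orthonormal [U], the projection onto its span; the equation [oproj U v = v] encodes
    membership in that span. *)
Definition oproj U v := \sum_(u <- U) dot u v *: u.

Lemma oprojD U v w : oproj U (v + w) = oproj U v + oproj U w.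
Proof. by rewrite -big_split; apply: eq_bigr => u _; rewrite dotDr scalerDl. Qed.

Lemma oprojZ U (a : R) v : oproj U (a *: v) = a *: oproj U v.
Proof.
by rewrite scaler_sumr; apply: eq_bigr => u _; rewrite dotZr scalerA.
Qed.

Lemma dot_oproj U v w : dot w (oproj U v) = \sum_(u <- U) dot u w * dot u v.
Proof.
rewrite dot_sumr; apply: eq_bigr => u _.
by rewrite dotZr (dotC w) mulrC.
Qed.

Lemma dot_oproj_mem U u v : orthonormal U -> u \in U ->
  dot u (oproj U v) = dot u v.
Proof.
elim: U => //= u1 U IH [u11 u1U oU].
rewrite /oproj big_cons dotDr dotZr -/(oproj U v) inE => /orP[/eqP ->|uU].
  rewrite u11 mulr1 dot_oproj big_seq big1 ?addr0 // => w wU.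
  by rewrite (dotC w) u1U ?mul0r.
by rewrite IH // (dotC u u1) (u1U _ uU) mulr0 add0r.
Qed.

(** The sum equals both [dot v (oproj U v)] and the squared norm of [oproj U v], so it differs from
    [sqnorm2 v] by the squared norm of the residual. *)
Lemma bessel U v : orthonormal U -> \sum_(u <- U) dot u v ^+ 2 <= sqnorm2 v.
Proof.
move=> oU; set S := \sum_(u <- U) _.
have SE : S = dot v (oproj U v).
  by rewrite dot_oproj; apply: eq_bigr => u _; rewrite expr2.
have S'E : S = dot (oproj U v) (oproj U v).
  rewrite dot_oproj /S big_seq [RHS]big_seq; apply: eq_bigr => u uU.
  by rewrite dot_oproj_mem // expr2.
have := dot_ge0 (v - oproj U v).
by rewrite !dotL -S'E (dotC _ v) -SE sqnorm2E; lra.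
Qed.

Lemma gram_schmidt (s : seq 'cV[R]_n) : exists U : seq 'cV[R]_n,
  [/\ orthonormal U, (size U <= size s)%N &
      forall v, v \in s -> oproj U v = v].
Proof.
elim: s => [|x s [U [oU sU Us]]]; first by exists [::].
have [r0|r0] := eqVneq (x - oproj U x) 0.
  exists U; split => //=; first exact: leqW.
  move=> v; rewrite inE => /orP[/eqP ->|/Us//].
  by apply/esym/eqP; rewrite -subr_eq0 r0.
set r := x - oproj U x in r0.
have rU u : u \in U -> dot u r = 0.
  by move=> uU; rewrite /r !dotL dot_oproj_mem // subrr.
have rr0 : 0 < dot r r by rewrite lt_neqAle eq_sym dot_eq0 r0 dot_ge0.
pose c := (Num.sqrt (dot r r))^-1.
have cc : c ^+ 2 * dot r r = 1.
  by rewrite /c exprVn sqr_sqrtr ?dot_ge0 // mulVf // gt_eqF.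
exists (c *: r :: U); split => //=.
  split=> // [|v vU]; first by rewrite dotZl dotZr mulrA -expr2.
  by rewrite dotZl dotC rU ?mulr0.
move=> v; rewrite /oproj big_cons -/(oproj U v) dotZl scalerA.
rewrite inE => /orP[/eqP ->|vs].
  have -> : dot r x = dot r r.
    have -> : x = r + oproj U x by rewrite /r subrK.
    rewrite [LHS]dotDr dot_oproj [X in _ + X]big_seq big1 ?addr0 // => u uU.
    by rewrite rU ?mul0r.
  by rewrite mulrAC -expr2 cc scale1r /r subrK.
(* Vectors treated earlier are orthogonal to the residual [r], so the new direction leaves their
   projection unchanged. *)
rewrite Us // -[in dot r v](Us _ vs) dot_oproj big_seq.
rewrite big1 ?mulr0 ?mul0r ?scale0r ?add0r //.
by move=> u uU; rewrite rU ?mul0r.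
Qed.

End Orthonormal.

Section Projection.
Variables (R : realType) (n p : nat) (X : 'M[R]_(n, p)) (T : {set 'I_p}).

(** A vector of the row space that is killed by the transpose is orthogonal to itself. *)
Lemma suppmx_cap : (<<suppmx X T>> :&: kermx (suppmx X T)^T)%MS = 0.
Proof.
set S := suppmx X T.
apply/eqP; rewrite -submx0; apply/rV_subP => v.
rewrite sub_capmx genmxE => /andP[/submxP[c vE]] /sub_kermxP vS.
have : dot v^T v^T = 0.
  by rewrite /dot trmxK {2}vE trmx_mul mulmxA vS mul0mx mxE.
by move/eqP; rewrite dot_eq0 -trmx0 => /eqP /trmx_inj ->; rewrite sub0mx.
Qed.

(** Rank count: the kernel has the complementary rank and the intersection is trivial. *)
Lemma suppmx_add (v : 'rV[R]_n) :
  (v <= <<suppmx X T>> + kermx (suppmx X T)^T)%MS.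
Proof.
apply: submx_full; rewrite /row_full.
have := mxrank_sum_cap <<suppmx X T>>%MS (kermx (suppmx X T)^T).
rewrite suppmx_cap mxrank0 addn0 => ->.
by rewrite genmxE mxrank_ker mxrank_tr subnKC // rank_leq_col.
Qed.

Lemma PiE (z : 'cV[R]_n) : Pi X T *m z =
  (z^T *m proj_mx <<suppmx X T>>%MS (kermx (suppmx X T)^T))^T.
Proof. by rewrite trmx_mul trmxK. Qed.

Lemma Pi_span (z : 'cV[R]_n) :
  exists c : 'I_p -> R, Pi X T *m z = \sum_(j in T) c j *: col j X.
Proof.
have := proj_mx_sub <<suppmx X T>>%MS (kermx (suppmx X T)^T) z^T.
rewrite genmxE => /submxP[c cE]; exists (fun j => c 0 j).
apply/colP => i; rewrite PiE cE !mxE summxE [RHS]big_mkcond /=.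
by apply: eq_bigr => j _; rewrite !mxE; case: ifP; rewrite ?mulr0.
Qed.

Lemma Pi_orth (z : 'cV[R]_n) j : j \in T -> dot (z - Pi X T *m z) (col j X) = 0.
Proof.
move=> jT.
have := proj_mx_compl_sub (suppmx_add z^T).
move=> /sub_kermxP /(congr1 (fun M : 'rV[R]_p => M 0 j)).
rewrite [RHS]mxE => h.
rewrite -[RHS]h PiE dotE mxE; apply: eq_bigr => i _.
by rewrite !mxE jT.
Qed.

Lemma Pi_dot (z w : 'cV[R]_n) : dot (z - Pi X T *m z) (Pi X T *m w) = 0.
Proof.
have [c ->] := Pi_span w.
by rewrite dot_sumr big1 // => j jT; rewrite dotZr Pi_orth ?mulr0.
Qed.

Lemma sqnorm2_Pi (z : 'cV[R]_n) :
  sqnorm2 (Pi X T *m z) = dot z (Pi X T *m z).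
Proof.
have := Pi_dot z z; rewrite sqnorm2E dotDl dotNl => /eqP.
by rewrite subr_eq0 => /eqP ->.
Qed.

End Projection.

(** Lets one orthonormal basis for [A] serve the projections of several supports, such as two
    supports inside their union. *)
Lemma Pi_oproj (R : realType) (n p : nat) (X : 'M[R]_(n, p)) (T A : {set 'I_p})
    U (z : 'cV[R]_n) : T \subset A ->
  (forall j, j \in A -> oproj U (col j X) = col j X) ->
  oproj U (Pi X T *m z) = Pi X T *m z.
Proof.
move=> TA UA; have [c ->] := Pi_span X T z.
elim/big_rec: _ => [|j x jT xU].
  by rewrite /oproj big1 // => u _; rewrite dot0r scale0r.
by rewrite oprojD oprojZ UA ?xU // (fintype.subsetP TA).
Qed.

Lemma orthonormal_columns (R : realType) (n p : nat) (X : 'M[R]_(n, p))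
    (A : {set 'I_p}) : exists U : seq 'cV[R]_n, [/\ orthonormal U,
  (size U <= #|A|)%N & forall j, j \in A -> oproj U (col j X) = col j X].
Proof.
have [U [oU sU UX]] := gram_schmidt [seq col j X | j <- enum A].
exists U; split=> //; first by rewrite size_map -cardE in sU.
by move=> j jA; apply: UX; apply: map_f; rewrite mem_enum.
Qed.

(** * Exponential moments of sub-Gaussian vectors *)

Section SubGaussian.
Variables (R : realType).

Local Notation leb := (@lebesgue_measure R).

Lemma normal_pdf1E (m s g : R) : 0 < s ->
  normal_pdf m s g =
    (Num.sqrt (2 * pi))^-1 * (s^-1 * expR (- (g - m) ^+ 2 / (2 * s ^+ 2))).
Proof.
move=> s0; rewrite normal_pdfE ?gt_eqF // /normal_peak /normal_fun mulrA.
congr (_ * expR (_ / _)); last by rewrite mulr_natl.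
rewrite -mulrnAr sqrtrM ?sqr_ge0 // sqrtr_sqr gtr0_norm // invfM mulrC.
by congr (_ * _); rewrite mulr_natl.
Qed.

(** The second hypothesis completes the square: the integrand is [s * expR b] times the density of a
    Gaussian with mean [t * s ^+ 2] and variance [s ^+ 2]. *)
Lemma integral_normal_pdf_exp (s c b t : R) : 0 < s ->
  (forall g, - g ^+ 2 / 2 + t * g + c * g ^+ 2 =
     b - (g - t * s ^+ 2) ^+ 2 / (2 * s ^+ 2)) ->
  (\int[leb]_g (normal_pdf 0 1 g * expR (t * g + c * g ^+ 2))%:E
   = (s * expR b)%:E)%E.
Proof.
move=> s0 H.
have E g : normal_pdf 0 1 g * expR (t * g + c * g ^+ 2) =
    s * expR b * normal_pdf (t * s ^+ 2) s g.
  rewrite !normal_pdf1E // invr1 expr1n subr0 mulr1 mul1r -[LHS]mulrA -expRD addrA H.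
  rewrite expRD mulNr; field.
  by rewrite !gt_eqF // sqrtr_gt0 mulr_gt0 // pi_gt0.
under eq_integral => g _ do rewrite E EFinM.
rewrite ge0_integralZl_EFin //.
- by rewrite integral_normal_pdf mule1.
- by move=> g _; rewrite lee_fin normal_pdf_ge0.
- by apply/measurable_EFinP; exact: measurable_normal_pdf.
- by rewrite mulr_ge0 ?expR_ge0 // ltW.
Qed.

Lemma measurable_coord n (i : 'I_n) :
  measurable_fun setT (fun u : 'cV[R]_n => u i 0).
Proof.
move=> _ Y mY; rewrite setTI; apply: sub_sigma_algebra.
rewrite -bigcup_seq /=; exists i => /=; first by rewrite mem_index_enum.
by exists Y => //; rewrite setTI.
Qed.

Lemma measurable_cVP d (T : measurableType d) n (f : T -> 'cV[R]_n) :
  measurable_fun setT f <->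
  forall i, measurable_fun setT (fun t => f t i 0).
Proof.
split=> [mf i|mf].
  exact: (measurableT_comp (measurable_coord i) mf).
apply: (@measurability _ _ _ _ _ _
  (\big[setU/set0]_(i < n) preimage_set_system setT (fun u : 'cV[R]_n => u i 0)
     measurable)) => //.
move=> _ [A + <-]; rewrite -bigcup_seq => -[/= i _ [B mB <-]].
by rewrite setTI -comp_preimage; exact: mf.
Qed.

Lemma measurable_dot n (v : 'cV[R]_n) : measurable_fun setT (dot v).
Proof.
rewrite (_ : dot v = fun u => \sum_i v i 0 * u i 0); last first.
  by apply/funext => u; rewrite dotE.
apply: measurable_sum => i; apply: measurable_funM => //.
exact: measurable_coord.
Qed.

Variables (n : nat) (d : measure_display) (Omega : measurableType d).
Variables (P : probability Omega R) (xi : {RV P >-> 'cV[R]_n}) (sigma : R).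
Hypothesis hsigma : 0 < sigma.
Hypothesis hxi : forall v : 'cV[R]_n,
  ('E_P[fun w => expR (dot v (xi w))] <=
     (expR (sigma ^+ 2 * sqnorm2 v / 2))%:E)%E.

Lemma measurable_dot_xi v : measurable_fun setT (fun w => dot v (xi w)).
Proof. exact: measurableT_comp (measurable_dot v) _. Qed.

(** For orthonormal [U], the squared norm of the projection of [z] onto its span. *)
Definition energy (U : seq 'cV[R]_n) (z : 'cV[R]_n) : R :=
  \sum_(u <- U) dot u z ^+ 2.

Lemma measurable_energy_xi U : measurable_fun setT (fun w => energy U (xi w)).
Proof.
rewrite /energy; apply: measurable_sum => u.
exact/measurable_funX/measurable_dot_xi.
Qed.

(* Conditionally on [xi], the factor [exp ((u.xi)^2 / (4 sigma^2))] is the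
   moment generating function of a standard Gaussian [g] at [u.xi / (sqrt 2 sigma)];
   by Tonelli, averaging over [xi] first only shifts [v] in the direction [u]. *)
Lemma subgaussian_chaos U v : orthonormal U ->
  (\int[P]_w (expR (dot v (xi w) + energy U (xi w) / (4 * sigma ^+ 2)))%:E <=
   (Num.sqrt 2 ^+ size U *
     expR (sigma ^+ 2 / 2 * (sqnorm2 v + energy U v)))%:E)%E.
Proof.
elim: U v => [|u U IH] v /=.
  move=> _; under eq_integral => w _ do rewrite /energy big_nil mul0r addr0.
  rewrite /energy big_nil addr0 expr0 mul1r mulrAC.
  by have := hxi v; rewrite unlock.
move=> [u1 uU oU].
have s2 : 0 < Num.sqrt 2 :> R by rewrite sqrtr_gt0.
have ss2 : Num.sqrt 2 ^+ 2 = 2 :> R by rewrite sqr_sqrtr.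
(* At this scale, integrating [expR (a * dot u (xi w) * g)] over the Gaussian [g] gives [expR (dot u
   (xi w) ^+ 2 / (4 * sigma ^+ 2))]. *)
pose a := (Num.sqrt 2 * sigma)^-1.
have a0 : a != 0 by rewrite invr_eq0 gt_eqF ?mulr_gt0.
have a2 : a ^+ 2 * (2 * sigma ^+ 2) = 1.
  by rewrite /a exprVn exprMn ss2 mulVf // gt_eqF // mulr_gt0 // exprn_gt0.
pose h w := expR (dot v (xi w) + energy U (xi w) / (4 * sigma ^+ 2)).
pose f (wg : Omega * R) :=
  (h wg.1 * (normal_pdf 0 1 wg.2 * expR (a * dot u (xi wg.1) * wg.2)))%:E.
have mh : measurable_fun setT h.
  apply: measurableT_comp => //; apply: measurable_funD.
    exact: measurable_dot_xi.
  by apply: measurable_funM => //; exact: measurable_energy_xi.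
have mf : measurable_fun setT f.
  apply/measurable_EFinP; apply: measurable_funM.
    exact: (measurableT_comp mh measurable_fst).
  apply: measurable_funM.
    exact: (measurableT_comp (measurable_normal_pdf 0 1) measurable_snd).
  apply: measurableT_comp => //; apply: measurable_funM => //.
  apply: measurable_funM => //.
  exact: (measurableT_comp (measurable_dot_xi u) measurable_fst).
have f0 wg : (0 <= f wg)%E.
  by rewrite lee_fin mulr_ge0 ?expR_ge0 // mulr_ge0 ?normal_pdf_ge0 ?expR_ge0.
rewrite (_ : (\int[P]_w _ = \int[P]_w \int[leb]_g f (w, g))%E); last first.
  apply: eq_integral => w _; rewrite /f /=.
  under eq_integral => g _ do rewrite EFinM.
  rewrite ge0_integralZl_EFin //; last 3 first.
  - by move=> g _; rewrite lee_fin mulr_ge0 ?normal_pdf_ge0 ?expR_ge0.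
  - apply/measurable_EFinP; apply: measurable_funM; first exact: measurable_normal_pdf.
    by apply: measurableT_comp => //; apply: measurable_funM.
  - by rewrite expR_ge0.
  rewrite (_ : (\int[leb]_g _ = \int[leb]_g (normal_pdf 0 1 g *
      expR (a * dot u (xi w) * g + 0 * g ^+ 2))%:E)%E); last first.
    by apply: eq_integral => g _; rewrite mul0r addr0.
  rewrite (@integral_normal_pdf_exp 1 _ (dot u (xi w) ^+ 2 / (4 * sigma ^+ 2)))
    ?ltr01 //; last first.
    move=> g; rewrite expr1n mulr1 mul0r addr0.
    have -> : dot u (xi w) ^+ 2 / (4 * sigma ^+ 2) = (a * dot u (xi w)) ^+ 2 / 2.
      rewrite -[LHS]mul1r -a2; field.
      by rewrite a0 gt_eqF.
    by field.
  by rewrite -EFinM mul1r /h -expRD /energy big_cons; congr (expR _)%:E; ring.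
rewrite fubini_tonelli //.
pose C := Num.sqrt 2 ^+ size U * expR (sigma ^+ 2 / 2 * (sqnorm2 v + energy U v)).
have eU g : energy U (v + (a * g) *: u) = energy U v.
  rewrite /energy big_seq [RHS]big_seq; apply: eq_bigr => u' u'U.
  by rewrite dotDr dotZr (dotC u' u) uU // mulr0 addr0.
(* For fixed [g] the induction hypothesis applies at the shifted vector; the squared shift
   contributes [sigma ^+ 2 * a ^+ 2 * g ^+ 2 / 2], which is [g ^+ 2 / 4]. *)
apply: (@le_trans _ _ (\int[leb]_g (C * (normal_pdf 0 1 g *
    expR ((sigma * dot u v / Num.sqrt 2) * g + 4^-1 * g ^+ 2)))%:E)%E).
  apply: ge0_le_integral => //.
  - by move=> g _; apply: integral_ge0 => w _.
  - exact: measurable_fun_fubini_tonelli_G.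
  - apply/measurable_EFinP; apply: measurable_funM => //.
    apply: measurable_funM; first exact: measurable_normal_pdf.
    apply: measurableT_comp => //.
    by apply: measurable_funD => //; apply: measurable_funM.
  move=> g _.
  rewrite (_ : (\int[P]_w _ = \int[P]_w ((normal_pdf 0 1 g)%:E *
      (expR (dot (v + (a * g) *: u) (xi w) +
             energy U (xi w) / (4 * sigma ^+ 2)))%:E))%E); last first.
    apply: eq_integral => w _; rewrite /f /= -EFinM /h; congr (_%:E).
    by rewrite mulrCA -expRD dotDl dotZl; congr (_ * expR _); ring.
  rewrite ge0_integralZl_EFin; [|by []| | |exact: normal_pdf_ge0]; last 2 first.
  - by move=> w _; rewrite lee_fin expR_ge0.
  - apply/measurable_EFinP; apply: measurableT_comp => //; apply: measurable_funD.
      exact: measurable_dot_xi.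
    by apply: measurable_funM => //; exact: measurable_energy_xi.
  apply: (le_trans (lee_wpmul2l _ (IH _ oU))).
    by rewrite lee_fin normal_pdf_ge0.
  rewrite -EFinM lee_fin eU [leRHS]mulrCA ler_wpM2l ?normal_pdf_ge0 //.
  rewrite /C -[leRHS]mulrA -expRD ler_wpM2l ?exprn_ge0 ?sqrtr_ge0 //.
  rewrite ler_expR le_eqVlt; apply/orP; left; apply/eqP.
  rewrite sqnorm2D !sqnorm2E dotZr !dotL u1 mulr1 (dotC v u).
  have -> : sigma * dot u v / Num.sqrt 2 = sigma ^+ 2 * a * dot u v.
    by rewrite /a; field; rewrite !gt_eqF.
  rewrite -[X in _ + X * g ^+ 2]mulr1 -a2; field.
  by rewrite a0 gt_eqF.
under eq_integral => g _ do rewrite EFinM.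
rewrite ge0_integralZl_EFin //; last 3 first.
- by move=> g _; rewrite lee_fin mulr_ge0 ?normal_pdf_ge0 ?expR_ge0.
- apply/measurable_EFinP; apply: measurable_funM; first exact: measurable_normal_pdf.
  apply: measurableT_comp => //.
  by apply: measurable_funD => //; apply: measurable_funM.
- by rewrite mulr_ge0 ?expR_ge0 // exprn_ge0 // sqrtr_ge0.
(* The quadratic part [- g ^+ 2 / 2 + g ^+ 2 / 4] is that of a Gaussian of variance 2, whose
   normalization yields one factor [Num.sqrt 2] per dimension. *)
rewrite (@integral_normal_pdf_exp (Num.sqrt 2) _
  (sigma ^+ 2 / 2 * dot u v ^+ 2)) //; last first.
  move=> g; rewrite ss2.
  have -> : (g - sigma * dot u v / Num.sqrt 2 * 2) ^+ 2 =
      g ^+ 2 - 4 * g * (sigma * dot u v / Num.sqrt 2) + 2 * (sigma * dot u v) ^+ 2.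
    have : sigma * dot u v / Num.sqrt 2 * (sigma * dot u v / Num.sqrt 2) * 2 =
        (sigma * dot u v) ^+ 2.
      by rewrite -[X in _ * X = _]ss2; field; rewrite gt_eqF.
    by move=> <-; ring.
  by field; rewrite gt_eqF.
rewrite -EFinM lee_fin le_eqVlt; apply/orP; left; apply/eqP.
rewrite /C /energy big_cons -/(energy U v).
rewrite (_ : _ * (_ + (_ + _)) =
  sigma ^+ 2 / 2 * (sqnorm2 v + energy U v) + sigma ^+ 2 / 2 * dot u v ^+ 2); last by ring.
by rewrite expRD [_ ^+ (size U).+1]exprS; ring.
Qed.

End SubGaussian.

(** * Weights *)

Section Weights.
Variables (R : realType) (p : nat).
Implicit Types T : {set 'I_p}.

Definition pen T : R := ln (1 / weight R T).

Lemma expR1_gt1 : 1 < expR 1 :> R.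
Proof. by rewrite expR_gt1. Qed.

Lemma Hp_ge1 : 1 <= Hp R p.
Proof.
rewrite /Hp ler_pdivlMr ?subr_gt0 ?expR1_gt1 // mul1r lerD2l lerN2.
by rewrite -expR0 ler_expR oppr_le0.
Qed.

Lemma sum_card_set (f : nat -> R) :
  \sum_(T : {set 'I_p}) f #|T| = \sum_(k < p.+1) 'C(p, k)%:R * f k.
Proof.
rewrite (partition_big (fun T : {set 'I_p} => inord #|T| : 'I_p.+1) predT) //=.
have cE (T : {set 'I_p}) : (inord #|T| : 'I_p.+1) = #|T| :> nat.
  by rewrite inordK // ltnS -[leqRHS]card_ord max_card.
apply: eq_bigr => k _; rewrite (eq_bigr (fun=> f k)); last first.
  by move=> T /eqP <-; rewrite cE.
rewrite sumr_const mulr_natl; congr (_ *+ _).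
transitivity #|[set A : {set 'I_p} | #|A| == k]%SET|; last first.
  by rewrite card_draws card_ord.
apply: eq_card => T.
by rewrite inE unfold_in /= cE.
Qed.

(** The number of supports of size [k] cancels the binomial in the weight, and the geometric sum of
    [expR (- k%:R)] over [k <= p] is exactly [Hp R p]. *)
Lemma sum_weight : \sum_(T : {set 'I_p}) weight R T = 1.
Proof.
have e0 := expR_gt0 (1 : R).
have e1 : expR 1 - 1 != 0 :> R by rewrite subr_eq0 gt_eqF ?expR1_gt1.
have H0 : Hp R p != 0 by rewrite gt_eqF // (lt_le_trans ltr01 Hp_ge1).
rewrite (sum_card_set (fun k => (Hp R p * 'C(p, k)%:R * expR 1 ^+ k)^-1)).
rewrite (eq_bigr (fun k : 'I_p.+1 => (Hp R p)^-1 * (expR 1)^-1 ^+ k)); last first.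
  move=> k _; rewrite exprVn; field; rewrite H0 expf_neq0 ?gt_eqF //=.
  by rewrite ltr0n bin_gt0 -ltnS.
rewrite -mulr_sumr -[RHS](mulVf H0); congr (_ * _).
have := subrX1 (expR 1 : R)^-1 p.+1.
rewrite /Hp expRN -[p%:R]mulr1 expRM_natl.
set S := \sum_(i < _) _ => H.
have -> : S = ((expR 1)^-1 ^+ p.+1 - 1) / ((expR 1)^-1 - 1).
  rewrite H mulrC mulKf // subr_eq0 lt_eqF //.
  by rewrite invf_lt1 ?expR1_gt1.
rewrite exprVn exprS; field.
apply/and4P; split; rewrite ?expf_neq0 ?(gt_eqF e0) //.
Qed.

Lemma weight_gt0 T : 0 < weight R T.
Proof.
have H0 : 0 < Hp R p by exact: lt_le_trans ltr01 Hp_ge1.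
have C0 : 0 < 'C(p, #|T|)%:R :> R.
  by rewrite ltr0n bin_gt0 -[leqRHS]card_ord max_card.
by rewrite invr_gt0 mulr_gt0 ?exprn_gt0 ?expR_gt0 // mulr_gt0.
Qed.

Lemma expR_pen T : expR (- pen T) = weight R T.
Proof.
by rewrite /pen div1r lnV ?posrE ?weight_gt0 // opprK lnK ?posrE ?weight_gt0.
Qed.

Lemma penE T : pen T = ln (Hp R p) + ln 'C(p, #|T|)%:R + #|T|%:R.
Proof.
have C0 : 0 < 'C(p, #|T|)%:R :> R by rewrite ltr0n bin_gt0 -[leqRHS]card_ord max_card.
have H0 : 0 < Hp R p by exact: lt_le_trans ltr01 Hp_ge1.
rewrite /pen /weight div1r invrK !lnM ?posrE ?mulr_gt0 ?exprn_gt0 ?expR_gt0 //.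
by rewrite lnXn ?expR_gt0 // expRK.
Qed.

(** The factor [expR 1 ^+ #|T|] in the weight lets the penalty pay for the dimension in the
    deviation thresholds. *)
Lemma card_le_pen T : #|T|%:R <= pen T.
Proof.
rewrite penE lerDr addr_ge0 ?ln_ge0 ?Hp_ge1 //.
by rewrite ler1n bin_gt0 -[leqRHS]card_ord max_card.
Qed.

Lemma pen_ge0 T : 0 <= pen T.
Proof. exact: le_trans (card_le_pen T). Qed.

(** Bounding [Hp R p] by [e / (e - 1)] and writing [t] for the square root of [e], it remains to see
    that [t ^+ 2 - t - 1] is nonnegative. *)
Lemma ln_Hp_le : ln (Hp R p) <= 2^-1.
Proof.
have e1 : 0 < expR 1 - 1 :> R by rewrite subr_gt0 expR1_gt1.
rewrite -ler_expR lnK ?posrE ?(lt_le_trans ltr01 Hp_ge1) //.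
pose t : R := expR 2^-1.
have t2 : expR 1 = t * t by rewrite /t -expRD; congr expR; lra.
(* [(1 + 1/16)^8] exceeds the golden ratio, the positive root of [t^2 - t - 1]. *)
have tge : 81 / 50 <= t.
  have -> : t = expR (16^-1) ^+ 8 by rewrite /t -expRM_natl; congr expR; lra.
  apply: (@le_trans _ _ ((1 + 16^-1) ^+ 8)); first by lra.
  by rewrite lerXn2r ?nnegrE ?expR_ge0 ?expR_ge1Dx //; lra.
rewrite /Hp ler_pdivrMr //.
apply: (@le_trans _ _ (expR 1)); first by rewrite gerBl expR_ge0.
by rewrite -/t t2; nra.
Qed.

(** With [q = k / p], a single term of the binomial expansion gives ['C(p, k) * q ^+ k <= (1 + q) ^+
    p <= expR k%:R]. *)
Lemma ln_bin_le k : (0 < k <= p)%N ->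
  ln 'C(p, k)%:R <= k%:R * ln (expR 1 * p%:R / k%:R) :> R.
Proof.
move=> /andP[k0 kp].
have p0 : (0 < p)%N by exact: leq_trans kp.
have kR : 0 < k%:R :> R by rewrite ltr0n.
have pR : 0 < p%:R :> R by rewrite ltr0n.
have q0 : 0 < k%:R / p%:R :> R by rewrite divr_gt0.
rewrite -ler_expR lnK ?posrE ?ltr0n ?bin_gt0 //.
rewrite expRM_natl lnK ?posrE ?mulr_gt0 ?invr_gt0 ?expR_gt0 //.
rewrite -mulrA exprMn -[p%:R / _]invf_div exprVn ler_pdivlMr ?exprn_gt0 //.
set q := k%:R / p%:R in q0 *.
apply: (@le_trans _ _ ((1 + q) ^+ p)).
  rewrite exprDn (bigD1 (Ordinal (kp : (k < p.+1)%N))) //=.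
  rewrite expr1n mul1r mulr_natl lerDl; apply: sumr_ge0 => i _.
  by rewrite expr1n mul1r mulrn_wge0 // exprn_ge0 // ltW.
apply: (@le_trans _ _ (expR q ^+ p)).
  by rewrite lerXn2r ?nnegrE ?expR_ge0 ?expR_ge1Dx // addr_ge0 // ltW.
rewrite -!expRM_natl mulr1 ler_expR /q mulrCA mulfV ?mulr1 //.
by rewrite gt_eqF.
Qed.

Lemma pen_le T : pen T <= 2^-1 + 2 * logterm R T.
Proof.
rewrite penE -addrA lerD ?ln_Hp_le // /logterm.
have [T0|T0] := posnP #|T|.
  by rewrite T0 bin0 ln1 !mul0r mulr0 addr0.
have Tp : (#|T| <= p)%N by rewrite -[leqRHS]card_ord max_card.
rewrite (maxn_idPl T0); set l := ln (_ / _).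
have TR : 0 < #|T|%:R :> R by rewrite ltr0n.
have := @ln_bin_le #|T|; rewrite T0 Tp => /(_ isT); rewrite -/l => H.
(* As [l] is at least 1, the summand [#|T|] costs a second copy of [#|T| * l], whence the factor
   2. *)
have l1 : 1 <= l.
  rewrite -ler_expR lnK ?posrE ?mulr_gt0 ?invr_gt0 ?expR_gt0 ?ltr0n ?(leq_trans T0) //.
  by rewrite -mulrA ler_peMr ?expR_ge0 // ler_pdivlMr // mul1r ler_nat.
have : #|T|%:R <= #|T|%:R * l by rewrite ler_peMr // ltW.
by lra.
Qed.

End Weights.

(** * Tails and measurability *)

Section Tails.
Variables (R : realType) (d : measure_display) (Omega : measurableType d).
Variable P : probability Omega R.

Lemma exp_markov (Z : Omega -> R) (b t : R) : measurable_fun setT Z ->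
  (\int[P]_w (expR (Z w))%:E <= (expR b)%:E)%E ->
  (P [set w | (t <= Z w)%R] <= (expR (b - t))%:E)%E.
Proof.
move=> mZ H; pose Z' : {RV P >-> R} := mfun_Sub (mem_set mZ).
have := @chernoff _ _ _ P Z' 1 t ltr01; rewrite mul1r /mmt_gen_fun unlock.
rewrite (_ : [set w | t <= Z' w]%R = [set w | t <= Z w]%R)//.
move=> /le_trans; apply; rewrite expRD EFinM lee_wpmul2r ?lee_fin ?expR_ge0 //.
apply: le_trans H; rewrite le_eqVlt; apply/orP; left; apply/eqP.
by apply: eq_integral => w _ /=; rewrite mulr1.
Qed.

Lemma union_bound (I : finType) (A : I -> set Omega) (a : I -> R) :
  (forall i, measurable (A i)) -> (forall i, (P (A i) <= (a i)%:E)%E) ->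
  measurable (\bigcup_i A i) /\ (P (\bigcup_i A i) <= (\sum_i a i)%:E)%E.
Proof.
move=> mA PA.
have -> : \bigcup_i A i = \big[setU/set0]_i A i.
  rewrite -bigcup_seq; apply/seteqP; split => w [i _ Aw]; exists i => //=.
  by rewrite mem_index_enum.
elim/big_rec2: _ => [|i s B _ [mB PB]]; first by rewrite measure0.
split; first exact: measurableU.
apply: (le_trans (measureU2 _ (mA i) mB)).
by rewrite EFinD; exact: leeD (PA i) PB.
Qed.

(** Meant for [D] the event that the variance is underestimated and [B] a deviation event;
    strictness comes from the bound on [P B]. *)
Lemma good_event (D B E : set Omega) (e : R) :
  measurable D -> measurable B -> measurable E ->
  (P B < e%:E)%E -> (forall w, ~ D w -> ~ B w -> E w) ->
  (1 - P D - e%:E < P E)%E.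
Proof.
move=> mD mB mE PB sub.
have fD := fin_num_measure P _ mD; have fE := fin_num_measure P _ mE.
have fB := fin_num_measure P _ mB.
have : (P setT <= P E + (P D + P B))%E.
  apply: (@le_trans _ _ (P (E `|` (D `|` B)))).
    apply: le_measure; rewrite ?inE //; first by do !apply: measurableU.
    move=> w _; have [Dw|nD] := pselect (D w); first by right; left.
    by have [Bw|nB] := pselect (B w); [right; right|left; exact: sub].
  apply: (le_trans (measureU2 _ mE (measurableU _ _ mD mB))).
  by rewrite leeD2l // measureU2.
move: PB; rewrite probability_setT -(fineK fD) -(fineK fE) -(fineK fB).
by rewrite -!EFinB -!EFinD !lte_fin lee_fin; lra.
Qed.

End Tails.

Lemma le_min_in (R : realType) (p : nat) (F : {set {set 'I_p}})
    (f : {set 'I_p} -> R) (a b : R) :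
  (a%:E <= min_in F f + b%:E)%E <-> forall T, T \in F -> a <= f T + b.
Proof.
rewrite -leeBlDr // -EFinB /min_in; split=> [H T TF|H].
  have := le_trans H (bigmin_le_cond _ _ TF).
  by rewrite lee_fin lerBlDr.
apply: le_bigmin; first exact: leey.
by move=> T TF; rewrite lee_fin lerBlDr; exact: H.
Qed.

Lemma measurable_le_set d (Omega : measurableType d) (R : realType)
    (f g : Omega -> R) : measurable_fun setT f -> measurable_fun setT g ->
  measurable [set w | f w <= g w].
Proof.
move=> mf mg.
rewrite (_ : [set w | _] = setT `&` (fun w => f w <= g w) @^-1` [set true]).
  exact: measurable_fun_ler.
by rewrite setTI; apply/seteqP; split.
Qed.

Section Measurability.
Variables (R : realType) (n p : nat).

Lemma measurable_sqnorm : measurable_fun setT (@sqnorm R n).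
Proof.
apply: measurable_funM => //; apply: measurable_sum => i.
by apply: measurable_funX; exact: measurable_coord.
Qed.

Lemma measurable_cVD d (Omega : measurableType d) (f g : Omega -> 'cV[R]_n) :
  measurable_fun setT f -> measurable_fun setT g ->
  measurable_fun setT (fun w => f w + g w).
Proof.
move=> /measurable_cVP mf /measurable_cVP mg; apply/measurable_cVP => i.
under eq_fun do rewrite mxE.
exact: measurable_funD.
Qed.

Lemma measurable_mulmx d (Omega : measurableType d) (A : 'M[R]_n)
    (f : Omega -> 'cV[R]_n) :
  measurable_fun setT f -> measurable_fun setT (fun w => A *m f w).
Proof.
move=> /measurable_cVP mf; apply/measurable_cVP => i.
under eq_fun do rewrite mxE.
by apply: measurable_sum => j; apply: measurable_funM.
Qed.

Lemma measurable_finite_cases d (Omega : measurableType d) (I : finType)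
    (s : Omega -> I) (f : I -> Omega -> R) :
  (forall i, measurable (s @^-1` [set i])) ->
  (forall i, measurable_fun setT (f i)) ->
  measurable_fun setT (fun w => f (s w) w).
Proof.
move=> ms mf.
rewrite (_ : (fun w => _) = fun w => \sum_i \1_(s @^-1` [set i]) w * f i w); last first.
  apply/funext => w; rewrite (bigD1 (s w)) //= big1 ?addr0.
    by rewrite indicE mem_set // mul1r.
  by move=> i si; rewrite indicE memNset ?mul0r //= => E; rewrite E eqxx in si.
by apply: measurable_sum => i; apply: measurable_funM.
Qed.

(** The random range of the quantifier is traded for a finite intersection, over all [T], of the
    events that [T] is outside [F w] or [Q T] holds. *)
Lemma measurable_forall_in d (Omega : measurableType d) (F : Omega -> {set {set 'I_p}})
    (Q : {set 'I_p} -> set Omega) :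
  (forall S, measurable (F @^-1` [set S])) ->
  (forall T, measurable (Q T)) ->
  measurable [set w | forall T, T \in F w -> Q T w].
Proof.
move=> mF mQ.
have mFT T : measurable [set w | T \in F w].
  rewrite (_ : [set w | _] =
      \bigcup_(S in [set S : {set {set 'I_p}} | T \in S]) (F @^-1` [set S]));
      last first.
    by apply/seteqP; split => [w Tw|w [S TS /= ->]] //; exists (F w).
  by apply: fin_bigcup_measurable.
rewrite (_ : [set w | _] = \bigcap_(T in [set: {set 'I_p}])
    (~` [set w | T \in F w] `|` Q T)); last first.
  apply/seteqP; split => w /= H T.
    move=> _; have [TF|TF] := boolP (T \in F w); first by right; exact: H.
    by left => /=; apply/negP.
  by move=> TF; have [/=|] := H T I.
apply: fin_bigcap_measurable => // T _; apply: measurableU => //.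
exact: measurableC.
Qed.

Lemma measurable_min_in d (Omega : measurableType d) (F : Omega -> {set {set 'I_p}})
    (g : Omega -> R) (f : {set 'I_p} -> Omega -> R) (c : R) :
  (forall S, measurable (F @^-1` [set S])) -> measurable_fun setT g ->
  (forall T, measurable_fun setT (f T)) ->
  measurable [set w | ((g w)%:E <= min_in (F w) (fun T => f T w) + c%:E)%E].
Proof.
move=> mF mg mf.
rewrite (_ : [set w | _] = [set w | forall T, T \in F w -> g w <= f T w + c]).
  apply: measurable_forall_in => // T.
  by apply: measurable_le_set => //; exact: measurable_funD.
by apply/seteqP; split => w /le_min_in.
Qed.

End Measurability.

(** * Deterministic oracle inequalities *)

Section Oracle.
Variables (R : realType) (n p : nat) (X : 'M[R]_(n, p)).
Implicit Types (T : {set 'I_p}) (mu y z w : 'cV[R]_n).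

(* Coordinatewise [2 a b - c b^2 <= a^2 / c]. *)
Lemma dot_le_energy U z w (c : R) : orthonormal U -> oproj U w = w -> 0 < c ->
  2 * dot z w - c * sqnorm2 w <= c^-1 * energy U z.
Proof.
move=> oU wU c0.
have -> : dot z w = \sum_(u <- U) dot u z * dot u w by rewrite -{1}wU dot_oproj.
have -> : sqnorm2 w = \sum_(u <- U) dot u w * dot u w.
  by rewrite sqnorm2E -{2}wU dot_oproj.
rewrite /energy !mulr_sumr -sumrB; apply: ler_sum => u _.
rewrite -subr_ge0 (_ : _ - _ = c^-1 * (dot u z - c * dot u w) ^+ 2).
  by rewrite mulr_ge0 ?invr_ge0 ?sqr_ge0 // ltW.
by field; rewrite gt_eqF.
Qed.

(** This is [dot_le_energy] at [w = Pi X T *m z] and [c = 1], where the left side is the squared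
    norm itself. *)
Lemma sqnorm2_Pi_le_energy U T z : orthonormal U ->
  oproj U (Pi X T *m z) = Pi X T *m z ->
  sqnorm2 (Pi X T *m z) <= energy U z.
Proof.
move=> oU zU; have := dot_le_energy z oU zU ltr01.
by rewrite -sqnorm2_Pi invr1 !mul1r; lra.
Qed.

(** Pythagoras: the bias is orthogonal to the range of the projection. *)
Lemma sqnorm2_Pi_risk T mu z : sqnorm2 (Pi X T *m (mu + z) - mu) =
  sqnorm2 (Pi X T *m mu - mu) + sqnorm2 (Pi X T *m z).
Proof.
rewrite mulmxDr addrAC sqnorm2D -opprB dotNl Pi_dot oppr0 mulr0 addr0.
by [].
Qed.

Section Aggregation.
Variables (F : {set {set 'I_p}}) (y : 'cV[R]_n) (s2 : R) (theta : 'cV[R]_#|F|).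

Local Notation m := (mutheta X y theta).
Local Notation mu_ := (@muj R n p X F y).

Let cost (j : 'I_#|F|) : R :=
  2^-1 * sqnorm2 (mu_ j) + 26 * s2 * pen R (enum_val j).

Lemma dot_mutheta v th :
  dot v (mutheta X y th) = \sum_j th j 0 * dot v (mu_ j).
Proof. by rewrite dot_sumr; apply: eq_bigr => j _; rewrite dotZr. Qed.

Lemma sum_sqnorm2_mutheta th v : simplex th ->
  \sum_j th j 0 * sqnorm2 (mu_ j - v) =
  \sum_j th j 0 * sqnorm2 (mu_ j) - 2 * dot v (mutheta X y th) + sqnorm2 v.
Proof.
move=> [th1 _].
have -> : sqnorm2 v = \sum_j th j 0 * sqnorm2 v by rewrite -mulr_suml th1 mul1r.
rewrite dot_mutheta mulr_sumr -sumrB -big_split; apply: eq_bigr => j _ /=.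
by rewrite sqnorm2D sqnorm2N dotNr (dotC v); ring.
Qed.

(** The dispersion around the aggregate removes half of its squared norm; all other terms are affine
    in [th]. *)
Lemma QcritE th : simplex th ->
  Qcrit X y s2 th = 2^-1 * sqnorm2 (mutheta X y th) - 2 * dot y (mutheta X y th)
    + sqnorm2 y + \sum_j th j 0 * cost j.
Proof.
move=> sth; rewrite /Qcrit sum_sqnorm2_mutheta // -sqnorm2E.
have -> : \sum_j th j 0 * cost j = 2^-1 * (\sum_j th j 0 * sqnorm2 (mu_ j))
    + 26 * s2 * \sum_j th j 0 * ln (1 / weight R (enum_val j)).
  rewrite !mulr_sumr -big_split; apply: eq_bigr => j _ /=.
  by rewrite /cost /pen; ring.
by rewrite sqnorm2D sqnorm2N dotNr (dotC y); lra.
Qed.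

(* First-order optimality towards the vertex [k]; the term [sqnorm2 (mu_ k - m) / 2]
   is the strong convexity gain. *)
Lemma Qminimizer_vertex (k : 'I_#|F|) : Qminimizer X y s2 theta ->
  Qcrit X y s2 theta + 2^-1 * sqnorm2 (mu_ k - m) <=
  sqnorm2 (mu_ k - y) + 26 * s2 * pen R (enum_val k).
Proof.
move=> [sth minth].
have [th1 th0] := sth.
pose q := 2^-1 * sqnorm2 (mu_ k - m).
pose S := \sum_j theta j 0 * cost j.
(* Along the segment from [theta] to the vertex [k], the criterion grows by [t * A + t ^+ 2 * q]. *)
pose A := dot m (mu_ k) - sqnorm2 m - 2 * (dot y (mu_ k) - dot y m) + cost k - S.
have q0 : 0 <= q by rewrite mulr_ge0 ?sqnorm2_ge0.
suff A0 : 0 <= A.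
  rewrite QcritE // -/S; move: A0; rewrite /A /cost.
  rewrite !sqnorm2D !sqnorm2N !dotNr (dotC (mu_ k) m) (dotC (mu_ k) y); lra.
have At t : 0 < t <= 1 -> 0 <= A + t * q.
  move=> /andP[t0 t1].
  pose th := (1 - t) *: theta + t *: delta_mx k 0.
  have sumth (f : 'I_#|F| -> R) : \sum_j th j 0 * f j =
      (1 - t) * (\sum_j theta j 0 * f j) + t * f k.
    have -> : f k = \sum_j (delta_mx k 0 : 'cV[R]_#|F|) j 0 * f j.
      rewrite (bigD1 k) //= mxE !eqxx mul1r big1 ?addr0 // => j jk.
      by rewrite mxE (negbTE jk) mul0r.
    rewrite !mulr_sumr -big_split; apply: eq_bigr => j _ /=.
    by rewrite !mxE; ring.
  have sth' : simplex th.
    split=> [|j].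
      have := sumth (fun=> 1); rewrite !mulr1.
      under eq_bigr do rewrite mulr1.
      under [in X in _ = X -> _]eq_bigr do rewrite mulr1.
      by rewrite th1 => ->; lra.
    rewrite !mxE addr_ge0 // mulr_ge0 ?th0 ?subr_ge0 // ?ler0n //.
    exact: ltW.
  have dth v : dot v (mutheta X y th) = (1 - t) * dot v m + t * dot v (mu_ k).
    by rewrite !dot_mutheta sumth.
  have := minth _ sth'; rewrite !QcritE // sumth -/S dth.
  have -> : sqnorm2 (mutheta X y th) = (1 - t) ^+ 2 * sqnorm2 m
      + 2 * t * (1 - t) * dot m (mu_ k) + t ^+ 2 * sqnorm2 (mu_ k).
    rewrite sqnorm2E dth !(dotC (mutheta X y th)) !dth !sqnorm2E (dotC (mu_ k)).
    by ring.
  move=> H; rewrite -(pmulr_rge0 _ t0) /q sqnorm2D sqnorm2N dotNr (dotC (mu_ k) m) /A.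
  by move: H; lra.
(* Were [A] negative, the step [t = - A / (q - A)], legitimate even if [q = 0], would make
   [A + t * q] negative. *)
rewrite leNgt; apply/negP => A0.
have qA : 0 < q - A by lra.
have := At (- A / (q - A)).
rewrite divr_gt0 ?oppr_gt0 // ler_pdivrMr // mul1r lerDr q0 => /(_ isT).
rewrite -(pmulr_rge0 _ qA).
have -> : (q - A) * (A + - A / (q - A) * q) = - A ^+ 2.
  by field; rewrite gt_eqF.
by rewrite oppr_ge0 leNgt exprn_even_gt0 //= lt_eqF.
Qed.

(** The strong convexity gain and the dispersion around the aggregate add up to the dispersion
    around [mu_ k]. *)
Lemma Qaggregate_risk (k : 'I_#|F|) mu z : y = mu + z -> Qminimizer X y s2 theta ->
  sqnorm2 (m - mu) <= sqnorm2 (mu_ k - mu)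
    + \sum_j theta j 0 * (2 * dot z (mu_ j - mu_ k) - 2^-1 * sqnorm2 (mu_ j - mu_ k)
                          - 26 * s2 * pen R (enum_val j))
    + 26 * s2 * pen R (enum_val k).
Proof.
move=> yE minth; have [sth _] := minth; have [th1 _] := sth.
have := Qminimizer_vertex k minth; rewrite /Qcrit.
have -> : \sum_j theta j 0 * (2 * dot z (mu_ j - mu_ k) - 2^-1 * sqnorm2 (mu_ j - mu_ k)
    - 26 * s2 * pen R (enum_val j)) = 2 * dot z (m - mu_ k)
    - 2^-1 * (\sum_j theta j 0 * sqnorm2 (mu_ j - mu_ k))
    - 26 * s2 * (\sum_j theta j 0 * pen R (enum_val j)).
  have -> : dot z (m - mu_ k) = \sum_j theta j 0 * dot z (mu_ j - mu_ k).
    have -> : dot z (m - mu_ k) = dot z m - \sum_j theta j 0 * dot z (mu_ k).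
      by rewrite -mulr_suml th1 mul1r dotDr dotNr.
    rewrite dot_mutheta -sumrB; apply: eq_bigr => j _.
    by rewrite dotDr dotNr mulrBr.
  by rewrite !mulr_sumr -!sumrB; apply: eq_bigr => j _; ring.
rewrite !sum_sqnorm2_mutheta //.
rewrite -[\sum_j theta j 0 * ln _]/(\sum_j theta j 0 * pen R (enum_val j)).
rewrite yE !sqnorm2D !sqnorm2N !(dotNr, dotDr) sqnorm2D -!sqnorm2E.
by rewrite (dotC z (mutheta _ _ _)) (dotC z (muj _ _ _)); lra.
Qed.

End Aggregation.

Lemma Qaggregate_oracle (F : {set {set 'I_p}}) (s2 sigma2 x : R)
    (theta : 'cV[R]_#|F|) mu z T :
  0 <= sigma2 -> sigma2 <= s2 -> 0 <= x -> Qminimizer X (mu + z) s2 theta ->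
  (forall T1 T2, exists U, [/\ orthonormal U,
     forall j, j \in T1 :|: T2 -> oproj U (col j X) = col j X &
     energy U z <= 6 * sigma2 * (x + pen R T1 + pen R T2)]) ->
  T \in F ->
  sqnorm2 (mutheta X (mu + z) theta - mu) <=
  sqnorm2 (Pi X T *m mu - mu) + s2 * (24 + 96 * logterm R T) + 22 * sigma2 * x.
Proof.
move=> s20 ss x0 minth HU TF.
pose k := enum_rank_in TF T.
have kT : enum_val k = T by rewrite enum_rankK_in.
have [[th1 th0] _] := minth.
have H := Qaggregate_risk k (erefl (mu + z)) minth.
(* Two energies bound the first two terms and a third absorbs [sqnorm2 (Pi X T *m z)]: [3 * 6 = 18],
   and the penalty of index [j] is covered because [18 <= 26]. *)
have bound j : 2 * dot z (muj X (mu + z) j - muj X (mu + z) k)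
    - 2^-1 * sqnorm2 (muj X (mu + z) j - muj X (mu + z) k)
    - 26 * s2 * pen R (enum_val j) <=
    18 * sigma2 * (x + pen R T) - sqnorm2 (Pi X T *m z).
  have [U [oU UX EU]] := HU (enum_val j) T.
  have sj : enum_val j \subset enum_val j :|: T by apply: finset.subsetUl.
  have sT : T \subset enum_val j :|: T by apply: finset.subsetUr.
  have wU : oproj U (muj X (mu + z) j - muj X (mu + z) k) =
      muj X (mu + z) j - muj X (mu + z) k.
    by rewrite -scaleN1r oprojD oprojZ /muj kT !(Pi_oproj _ _ UX).
  have h2 : (0 : R) < 2^-1 by rewrite invr_gt0.
  have := dot_le_energy z oU wU h2; rewrite invrK.
  have := sqnorm2_Pi_le_energy oU (Pi_oproj z sT UX).
  have : sigma2 * pen R (enum_val j) <= s2 * pen R (enum_val j).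
    by rewrite ler_wpM2r ?pen_ge0.
  have : 0 <= sigma2 * pen R (enum_val j) by rewrite mulr_ge0 ?pen_ge0.
  by move: EU; lra.
move: H; rewrite {1}/muj kT sqnorm2_Pi_risk => H.
set B := 18 * sigma2 * (x + pen R T) - _ in bound.
have sB : \sum_j theta j 0 * (2 * dot z (muj X (mu + z) j - muj X (mu + z) k)
    - 2^-1 * sqnorm2 (muj X (mu + z) j - muj X (mu + z) k)
    - 26 * s2 * pen R (enum_val j)) <= B.
  rewrite -[leRHS]mul1r -[in leRHS]th1 mulr_suml.
  by apply: ler_sum => j _; rewrite ler_wpM2l.
(* The total factor on [pen R T] is [18 + 26 = 44], below the 48 in
   [24 + 96 * l = 48 * (2^-1 + 2 * l)]. *)
have penT : s2 * pen R T <= s2 * (2^-1 + 2 * logterm R T).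
  by rewrite ler_wpM2l ?pen_le // (le_trans s20).
have : sigma2 * pen R T <= s2 * pen R T by rewrite ler_wpM2r ?pen_ge0.
have : 0 <= sigma2 * pen R T by rewrite mulr_ge0 ?pen_ge0.
have : 0 <= sigma2 * x by rewrite mulr_ge0.
by move: H sB penT; rewrite /B; lra.
Qed.

Lemma selcritE T (s2 : R) mu z : selcrit X (mu + z) s2 T =
  sqnorm2 (mu - Pi X T *m mu) + 2 * dot z (mu - Pi X T *m mu) + sqnorm2 z
  - sqnorm2 (Pi X T *m z) + 18 * s2 * pen R T.
Proof.
rewrite /selcrit -/(pen R T) mulmxDr.
rewrite (_ : mu + z - _ = (mu - Pi X T *m mu) + (z - Pi X T *m z)); last first.
  by rewrite opprD addrACA.
rewrite sqnorm2D.
have -> : sqnorm2 (z - Pi X T *m z) = sqnorm2 z - sqnorm2 (Pi X T *m z).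
  by rewrite sqnorm2D sqnorm2N dotNr -sqnorm2_Pi; lra.
by rewrite dotDr dotNr Pi_dot (dotC z); lra.
Qed.

(** Adding the bounds at [That] and at [T] to the comparison of criteria leaves half the risk of
    [That] on the left. The penalty of [That] drops out because [8 * (3 / 2) <= 18]; doubling gives
    the factor 3 on the bias and [2 * (18 + 4) = 44 <= 52] on the penalty of [T]. *)
Lemma selection_oracle (F : {set {set 'I_p}}) (s2 sigma2 x : R) mu z That T :
  0 <= sigma2 -> sigma2 <= s2 -> 0 <= x -> selminimizer X F (mu + z) s2 That ->
  (forall T, - (2 * dot z (mu - Pi X T *m mu)) - 2^-1 * sqnorm2 (mu - Pi X T *m mu)
     + 3 / 2 * sqnorm2 (Pi X T *m z) <= 8 * sigma2 * (7 / 6 * x + 3 / 2 * pen R T)) ->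
  (forall T, 2 * dot z (mu - Pi X T *m mu) - 2^-1 * sqnorm2 (mu - Pi X T *m mu)
     <= 4 * sigma2 * (7 / 6 * x + pen R T)) ->
  T \in F ->
  sqnorm2 (Pi X That *m (mu + z) - mu) <=
  3 * sqnorm2 (Pi X T *m mu - mu) + s2 * (26 + 104 * logterm R T) + 28 * sigma2 * x.
Proof.
move=> s20 ss x0 [_ minT] HJ HK TF.
have := minT _ TF; rewrite !selcritE sqnorm2_Pi_risk.
rewrite -[Pi X That *m mu - mu]opprB -[Pi X T *m mu - mu]opprB !sqnorm2N.
have penT : s2 * pen R T <= s2 * (2^-1 + 2 * logterm R T).
  by rewrite ler_wpM2l ?pen_le // (le_trans s20).
have : sigma2 * pen R That <= s2 * pen R That by rewrite ler_wpM2r ?pen_ge0.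
have : sigma2 * pen R T <= s2 * pen R T by rewrite ler_wpM2r ?pen_ge0.
have : 0 <= sigma2 * pen R T by rewrite mulr_ge0 ?pen_ge0.
have : 0 <= sigma2 * pen R That by rewrite mulr_ge0 ?pen_ge0.
have := sqnorm2_ge0 (Pi X T *m z).
by move: (HJ That) (HK T) penT; lra.
Qed.

End Oracle.

(** * Uniform deviation bounds *)

Section UniformBounds.
Variables (R : realType) (n p : nat) (X : 'M[R]_(n, p)).
Variables (d : measure_display) (Omega : measurableType d).
Variables (P : probability Omega R) (xi : {RV P >-> 'cV[R]_n}) (sigma : R).
Hypothesis hsigma : 0 < sigma.
Hypothesis hxi : forall v : 'cV[R]_n,
  ('E_P[fun w => expR (dot v (xi w))] <=
     (expR (sigma ^+ 2 * sqnorm2 v / 2))%:E)%E.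

Lemma sqrt2_le : Num.sqrt 2 <= expR (2^-1) :> R.
Proof.
apply: (@le_trans _ _ (1 + 2^-1)); last exact: expR_ge1Dx.
by rewrite -(@ler_pXn2r _ 2) ?nnegrE ?sqrtr_ge0 // sqr_sqrtr //; lra.
Qed.

(* The threshold exceeds [t] by the logarithm of the bound of
   [subgaussian_chaos], with [sqrt 2 ^ k] replaced by [exp (k / 2)]. *)
Definition chaos_event U (v : 'cV[R]_n) (a t : R) : set Omega :=
  [set w | t + a / 2 + sigma ^+ 2 / 2 * (sqnorm2 v + energy U v) <=
           dot v (xi w) + energy U (xi w) / (4 * sigma ^+ 2)].

Lemma measurable_chaos U v :
  measurable_fun setT (fun w => dot v (xi w) + energy U (xi w) / (4 * sigma ^+ 2)).
Proof.
apply: measurable_funD; first exact: measurable_dot_xi.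
by apply: measurable_funM => //; exact: measurable_energy_xi.
Qed.

Lemma measurable_chaos_event U v a t : measurable (chaos_event U v a t).
Proof.
apply: measurable_le_set; [exact: measurable_cst|exact: measurable_chaos].
Qed.

(** [a] need only bound the dimension, so the cardinality of a support can stand in for the rank of
    its columns. *)
Lemma chaos_tail U v (a : nat) t : orthonormal U -> (size U <= a)%N ->
  (P (chaos_event U v a%:R t) <= (expR (- t))%:E)%E.
Proof.
move=> oU Ua.
set c := a%:R / 2 + sigma ^+ 2 / 2 * (sqnorm2 v + energy U v).
have := @exp_markov _ _ _ P _ c (t + c) (measurable_chaos U v).
have -> : c - (t + c) = - t by ring.
rewrite /chaos_event -addrA -/c; apply.
apply: (le_trans (subgaussian_chaos hsigma hxi v oU)).
rewrite lee_fin /c expRD ler_wpM2r ?expR_ge0 //.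
rewrite expRM_natl.
apply: (@le_trans _ _ (expR (2^-1) ^+ size U)).
  by rewrite lerXn2r ?nnegrE ?sqrtr_ge0 ?expR_ge0 ?sqrt2_le.
by rewrite ler_weXn2l // (le_trans _ (expR_ge1Dx _)) //; lra.
Qed.

Let span_basis T := projT1 (cid (orthonormal_columns X T)).

Let span_basisP T : [/\ orthonormal (span_basis T), (size (span_basis T) <= #|T|)%N &
  forall j, j \in T -> oproj (span_basis T) (col j X) = col j X].
Proof. exact: projT2 (cid (orthonormal_columns X T)). Qed.

(** Since [expR (- pen R T) = weight R T], the probabilities sum to at most [expR (- x)] times the
    total weight 1. *)
Lemma union_weight (A : {set 'I_p} -> set Omega) (x : R) :
  (forall T, measurable (A T)) ->
  (forall T, (P (A T) <= (expR (- (x + pen R T)))%:E)%E) ->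
  measurable (\bigcup_T A T) /\ (P (\bigcup_T A T) <= (expR (- x))%:E)%E.
Proof.
move=> mA PA; have [mB PB] := union_bound mA PA; split=> //.
apply: (le_trans PB); rewrite lee_fin.
under eq_bigr do rewrite opprD expRD expR_pen.
by rewrite -mulr_sumr sum_weight mulr1.
Qed.

Lemma energy_uniform (x : R) : 0 <= x -> exists B, [/\ measurable B,
  (P B <= (expR (- x))%:E)%E & forall w, ~ B w -> forall T1 T2, exists U,
    [/\ orthonormal U, forall j, j \in T1 :|: T2 -> oproj U (col j X) = col j X &
        energy U (xi w) <= 6 * sigma ^+ 2 * (x + pen R T1 + pen R T2)]].
Proof.
move=> x0; pose A T1 T2 := chaos_event (span_basis (T1 :|: T2)) 0 #|T1 :|: T2|%:R
  (x + pen R T2 + pen R T1).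
have mA T1 T2 : measurable (A T1 T2) by exact: measurable_chaos_event.
have PA T1 T2 : (P (A T1 T2) <= (expR (- (x + pen R T2 + pen R T1)))%:E)%E.
  by have [oU sU _] := span_basisP (T1 :|: T2); exact: chaos_tail.
(* The union over pairs is taken in two passes, first over [T1] at level [x + pen R T2]. *)
have H2 T2 := union_weight (mA^~ T2) (PA^~ T2).
have [mB PB] := union_weight (fun T2 => (H2 T2).1) (fun T2 => (H2 T2).2).
exists (\bigcup_T2 \bigcup_T1 A T1 T2); split=> // w nB T1 T2.
have [oU sU UX] := span_basisP (T1 :|: T2).
exists (span_basis (T1 :|: T2)); split=> //.
have /negP : ~ A T1 T2 w by move=> Aw; apply: nB; exists T2 => //; exists T1.
rewrite -ltNge (dotC 0) dot0r add0r.
rewrite sqnorm2E dot0r add0r /energy [X in _ / 2 * X]big1 ?mulr0 ?addr0; last first.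
  by move=> u _; rewrite dot0r expr0n.
rewrite ltr_pdivrMr ?mulr_gt0 ?exprn_gt0 // => /ltW /le_trans; apply.
(* The dimension enters the threshold with factor one half, which gives [4 * (1 + 1 / 2) = 6]. *)
have cU : #|T1 :|: T2|%:R <= pen R T1 + pen R T2.
  apply: (@le_trans _ _ (#|T1| + #|T2|)%N%:R); first by rewrite ler_nat leq_card_setU.
  by rewrite natrD lerD ?card_le_pen.
have : 0 <= sigma ^+ 2 * (pen R T1 + pen R T2 - #|T1 :|: T2|%:R).
  by rewrite mulr_ge0 ?sqr_ge0 // subr_ge0.
have : 0 <= sigma ^+ 2 * x by rewrite mulr_ge0 ?sqr_ge0.
by lra.
Qed.

(* Exponential moment at [1 / (4 sigma^2)]. *)
Lemma bias_uniform mu (x : R) : exists B, [/\ measurable B,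
  (P B <= (expR (- x))%:E)%E & forall w, ~ B w -> forall T,
    2 * dot (xi w) (mu - Pi X T *m mu) - 2^-1 * sqnorm2 (mu - Pi X T *m mu)
     <= 4 * sigma ^+ 2 * (x + pen R T)].
Proof.
pose v T := (2 * sigma ^+ 2)^-1 *: (mu - Pi X T *m mu).
(* The empty list drops the quadratic part, leaving a linear form in [xi] and dimension 0. *)
have mA T := measurable_chaos_event [::] (v T) 0 (x + pen R T).
have PA T : (P (chaos_event [::] (v T) 0 (x + pen R T)) <=
    (expR (- (x + pen R T)))%:E)%E by exact: (@chaos_tail [::] _ 0).
have [mB PB] := union_weight mA PA.
exists (\bigcup_T chaos_event [::] (v T) 0 (x + pen R T)); split=> // w nB T.
have /negP : ~ chaos_event [::] (v T) 0 (x + pen R T) w.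
  by move=> Aw; apply: nB; exists T.
rewrite -ltNge /energy !big_nil !mul0r !addr0 /v dotZl sqnorm2Z.
rewrite (dotC (xi w)); set D := dot _ (xi w); set N := sqnorm2 _ => H.
have s0 : 0 < 4 * sigma ^+ 2 by rewrite mulr_gt0 ?exprn_gt0.
move: H; rewrite -(ltr_pM2l s0) => /ltW.
have -> : 4 * sigma ^+ 2 * ((2 * sigma ^+ 2)^-1 * D) = 2 * D.
  by field; rewrite gt_eqF.
have -> : 4 * sigma ^+ 2 * (x + pen R T + sigma ^+ 2 / 2 *
    ((2 * sigma ^+ 2)^-1 ^+ 2 * N)) =
    4 * sigma ^+ 2 * (x + pen R T) + 2^-1 * N.
  by field; rewrite gt_eqF.
by lra.
Qed.

(* Exponential moment at [1 / (8 sigma^2)]: Bessel's inequality crudely bounds the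
   cross term of [subgaussian_chaos], which then exactly matches the [2^-1]. *)
Lemma variance_uniform mu (x : R) : exists B, [/\ measurable B,
  (P B <= (expR (- x))%:E)%E & forall w, ~ B w -> forall T,
    - (2 * dot (xi w) (mu - Pi X T *m mu)) - 2^-1 * sqnorm2 (mu - Pi X T *m mu)
     + 3 / 2 * sqnorm2 (Pi X T *m xi w) <= 8 * sigma ^+ 2 * (x + 3 / 2 * pen R T)].
Proof.
pose v T := - (4 * sigma ^+ 2)^-1 *: (mu - Pi X T *m mu).
pose A T := chaos_event (span_basis T) (v T) #|T|%:R (x + pen R T).
have mA T : measurable (A T) by exact: measurable_chaos_event.
have PA T : (P (A T) <= (expR (- (x + pen R T)))%:E)%E.
  by have [oU sU _] := span_basisP T; exact: chaos_tail.
have [mB PB] := union_weight mA PA.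
exists (\bigcup_T A T); split=> // w nB T.
have [oU sU UX] := span_basisP T.
have /negP : ~ A T w by move=> Aw; apply: nB; exists T.
have := bessel (v T) oU; rewrite -/(energy _ _).
have := sqnorm2_Pi_le_energy oU (Pi_oproj (xi w) (fintype.subxx _) UX).
rewrite -ltNge; set E := energy _ (xi w); set E' := energy _ (v T).
rewrite {1 3}/v dotZl sqnorm2Z (dotC (xi w)).
set D := dot _ (xi w); set N := sqnorm2 (mu - _); set Q := sqnorm2 _ => QE E'N H.
have s0 : 0 < 8 * sigma ^+ 2 by rewrite mulr_gt0 ?exprn_gt0.
have {}E'N : 8 * sigma ^+ 2 * (sigma ^+ 2 / 2 * E') <= 4^-1 * N.
  have -> : 4^-1 * N =
      8 * sigma ^+ 2 * (sigma ^+ 2 / 2 * ((- (4 * sigma ^+ 2)^-1) ^+ 2 * N)).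
    by field; rewrite gt_eqF.
  by rewrite !ler_wpM2l // ?divr_ge0 ?sqr_ge0 // ltW.
move: H; rewrite -(ltr_pM2l s0) => /ltW.
have -> : 8 * sigma ^+ 2 * (- (4 * sigma ^+ 2)^-1 * D + E / (4 * sigma ^+ 2)) =
    - (2 * D) + 2 * E.
  by field; rewrite gt_eqF.
have -> : 8 * sigma ^+ 2 * (x + pen R T + #|T|%:R / 2 +
    sigma ^+ 2 / 2 * ((- (4 * sigma ^+ 2)^-1) ^+ 2 * N + E')) =
    8 * sigma ^+ 2 * (x + pen R T + #|T|%:R / 2) + 4^-1 * N +
    8 * sigma ^+ 2 * (sigma ^+ 2 / 2 * E').
  by field; rewrite gt_eqF.
(* The dimension term turns the factor 8 on [pen R T] into [8 * (3 / 2)], and [2 * E] dominates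
   [3 / 2 * Q]. *)
have : 8 * sigma ^+ 2 * #|T|%:R <= 8 * sigma ^+ 2 * pen R T.
  by rewrite ler_wpM2l ?card_le_pen // ltW.
have : 0 <= Q by exact: sqnorm2_ge0.
by lra.
Qed.

End UniformBounds.

(** * Both oracle inequalities in probability *)

Theorem theorem1 (R : realType) (n p : nat) (hn : (0 < n)%N) (hp : (0 < p)%N)
  (sigma : R) (hsigma : 0 < sigma) (mu : 'cV[R]_n) (X : 'M[R]_(n, p))
  (d : measure_display) (Omega : measurableType d) (P : probability Omega R)
  (xi : {RV P >-> 'cV[R]_n})
  (hxi : forall v : 'cV[R]_n,
    ('E_P[fun w => expR ((v^T *m xi w) 0 0)%R]
       <= (expR (sigma ^+ 2 * sqnorm2 v / 2)%R)%:E)%E)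
  (Fhat : 'cV[R]_n -> {set {set 'I_p}})
  (mFhat : forall S : {set {set 'I_p}}, measurable (Fhat @^-1` [set S]))
  (Fhat_neq0 : forall u : 'cV[R]_n, Fhat u != finset.set0)
  (s2hat : 'cV[R]_n -> R)
  (ms2hat : measurable_fun setT s2hat)
  (s2hat_ge0 : forall u : 'cV[R]_n, 0 <= s2hat u) :
  let y := fun w : Omega => mu + xi w in
  let delta := P [set w | s2hat (y w) < sigma ^+ 2] in
  (forall (thetahat : forall u : 'cV[R]_n, 'cV[R]_#|Fhat u|)
     (muQ := fun u : 'cV[R]_n => mutheta X u (thetahat u)),
     (forall u : 'cV[R]_n, Qminimizer X u (s2hat u) (thetahat u)) ->
     measurable_fun setT muQ ->
     forall x : R, 0 < x ->
     (1 - delta - (2 * expR (- x))%R%:E <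
       P [set w | (sqnorm (muQ (y w) - mu)%R)%:E <=
            min_in (Fhat (y w)) (fun T => (sqnorm (Pi X T *m mu - mu)
              + s2hat (y w) / n%:R * (24 + 96 * logterm R T))%R)
            + (22 * sigma ^+ 2 * x / n%:R)%R%:E])%E)
  /\
  (forall That : 'cV[R]_n -> {set 'I_p},
     (forall u : 'cV[R]_n, selminimizer X (Fhat u) u (s2hat u) (That u)) ->
     (forall T : {set 'I_p}, measurable (That @^-1` [set T])) ->
     forall x : R, 0 < x ->
     (1 - delta - (2 * expR (- x))%R%:E <
       P [set w | (sqnorm (Pi X (That (y w)) *m y w - mu)%R)%:E <=
            min_in (Fhat (y w)) (fun T => (3 * sqnorm (Pi X T *m mu - mu)
              + s2hat (y w) / n%:R * (26 + 104 * logterm R T))%R)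
            + (28 * sigma ^+ 2 * x / n%:R)%R%:E])%E).
Proof.
move=> y delta.
have my : measurable_fun setT y by exact: measurable_cVD.
have mF S : measurable ((fun w => Fhat (y w)) @^-1` [set S]).
  by have := my measurableT _ (mFhat S); rewrite setTI.
have ms2 : measurable_fun setT (s2hat \o y) by exact: measurableT_comp.
have mD : measurable [set w | s2hat (y w) < sigma ^+ 2].
  rewrite (_ : [set w | _] = ~` [set w | sigma ^+ 2 <= s2hat (y w)]).
    by apply: measurableC; exact: measurable_le_set.
  by apply/seteqP; split => w /=; [rewrite ltNge => /negP|move/negP; rewrite ltNge].
have s20 : 0 <= sigma ^+ 2 by rewrite sqr_ge0.
have nR : 0 < n%:R :> R by rewrite ltr0n.
have normalize (a b c r x : R) (w : Omega) :
    a <= b + s2hat (y w) * c + r * sigma ^+ 2 * x ->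
    n%:R^-1 * a <= n%:R^-1 * b + s2hat (y w) / n%:R * c + r * sigma ^+ 2 * x / n%:R.
  rewrite -(ler_pM2l (_ : 0 < n%:R^-1 :> R)) ?invr_gt0 // => /le_trans; apply.
  by rewrite le_eqVlt; apply/orP; left; apply/eqP; ring.
split.
- move=> thetahat muQ minth mmuQ x x0.
  have [B [mB PB HB]] := energy_uniform X hsigma hxi (ltW x0).
  apply: (good_event mD mB).
  + apply: measurable_min_in => //.
      apply: (measurableT_comp (@measurable_sqnorm R n)).
      apply: measurable_cVD => //.
      exact: measurableT_comp.
    by move=> T; apply: measurable_funD => //; do 2 apply: measurable_funM => //.
  (* A single event of probability at most [expR (- x)] suffices here; the spare factor 2 gives the
     strict inequality. *)
  + apply: (le_lt_trans PB); rewrite lte_fin.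
    by have := expR_gt0 (- x); lra.
  move=> w /negP; rewrite -leNgt => ss /HB HU /=.
  apply/le_min_in => T TF; rewrite /sqnorm; apply: normalize.
  exact: (Qaggregate_oracle s20 ss (ltW x0) (minth (y w)) HU).
move=> That minT mThat x x0.
(* [2 * (4 + 8) * (7 / 6) = 28]; the factor [7 / 6 > 1] makes the bound strict. *)
have [B1 [mB1 PB1 HB1]] := bias_uniform X hsigma hxi mu (7 / 6 * x).
have [B2 [mB2 PB2 HB2]] := variance_uniform X hsigma hxi mu (7 / 6 * x).
apply: (good_event mD (measurableU _ _ mB1 mB2)).
- apply: measurable_min_in => //.
    apply: (@measurable_finite_cases _ _ _ _ (fun w => That (y w))
      (fun T w => sqnorm (Pi X T *m y w - mu))) => T.
      by have := my measurableT _ (mThat T); rewrite setTI.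
    apply: (measurableT_comp (@measurable_sqnorm R n)).
    by apply: measurable_cVD => //; exact: measurable_mulmx.
  by move=> T; apply: measurable_funD => //; do 2 apply: measurable_funM => //.
- apply: (le_lt_trans (measureU2 _ mB1 mB2)).
  apply: (le_lt_trans (leeD PB1 PB2)); rewrite -EFinD lte_fin.
  have : expR (- (7 / 6 * x)) < expR (- x) by rewrite ltr_expR; lra.
  by lra.
move=> w /negP; rewrite -leNgt => ss nB /=.
have /HB1 H1 : ~ B1 w by move=> ?; apply: nB; left.
have /HB2 H2 : ~ B2 w by move=> ?; apply: nB; right.
apply/le_min_in => T TF; rewrite /sqnorm mulrCA; apply: normalize.
exact: (selection_oracle s20 ss (ltW x0) (minT (y w)) H2 H1).
Qed.
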